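(* Let $\Omega\subset\mathbb R^n$ be open, let $\omega$ be a weight on $\Omega$ and let $\varphi\in\Phi_w(\Omega)$. Assume that $\chi_{B\cap\Omega}\in L^{\varphi(\cdot)}_\omega(\Omega)$ for all balls $B\subset\mathbb R^n$ with $B\cap\Omega\neq\emptyset$. If $\mathcal M_\Omega: L^{\varphi(\cdot)}_\omega(\Omega)\to L^{\varphi(\cdot)}_\omega(\Omega)$ is bounded, then $\omega\in A_\varphi(\Omega)$, i.e. $$\sup_{B\subset\mathbb R^n}\frac{\|\chi_{B\cap\Omega}\|_{L^{\varphi(\cdot)}_\omega(\Omega)}\,\|\chi_{B\cap\Omega}\|_{(L^{\varphi(\cdot)}_\omega(\Omega))'}}{|B|}<\infty,$$ the supremum being over all balls $B$ in $\mathbb R^n$ (with $B\cap\Omega\ne\emptyset$).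
   Context: A ball is a Euclidean ball $B\subset\mathbb R^n$; $\chi_E$ is the characteristic function of $E$. A weight on $\Omega$ is a measurable function $\omega$ with $0<\omega(x)<\infty$ for a.e. $x\in\Omega$ and $\int_{B\cap\Omega}\omega\,dx<\infty$ for every bounded ball $B\subset\mathbb R^n$. The ambient-domain maximal operator is $$\mathcal M_\Omega f(x)=\sup_{B\ni x}\frac1{|B|}\int_{B\cap\Omega}|f(y)|\,dy,\qquad x\in\Omega,$$ the supremum being over all balls $B\subset\mathbb R^n$ containing $x$. $\Phi_w(\Omega)$ is the class of functions $\Phi:\Omega\times[0,\infty)\to[0,\infty]$ such that $\Phi(\cdot,|f|)$ is measurable for every measurable $f:\Omega\to\mathbb R$; for a.e. $x$, $t\mapsto\Phi(x,t)$ is increasing (not necessarily strictly), $\Phi(x,0)=\lim_{t\to0+}\Phi(x,t)=0$, $\lim_{t\to\infty}\Phi(x,t)=\infty$; and there is $L\ge1$ with $\Phi(x,s)/s\le L\,\Phi(x,t)/t$ for a.e. $x$ and all $0<s<t$. $\|f\|_{L^{\varphi(\cdot)}_\omega(\Omega)}=\inf\{\lambda>0:\int_\Omega\varphi(x,|f(x)|/\lambda)\omega(x)\,dx\le1\}$; the space $L^{\varphi(\cdot)}_\omega(\Omega)$ consists of the measurable $f$ for which this is finite. Bounded means $\|\mathcal M_\Omega f\|\le C\|f\|$ for all $f$ in the space, in this functional. With $X=L^{\varphi(\cdot)}_\omega(\Omega)$, the Köthe associate is taken with respect to Lebesgue measure: $\|g\|_{X'}=\sup_{\|f\|_X\le1}\int_\Omega|f(x)g(x)|\,dx$.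 *)

(* Defs.v *)
From HB Require Import structures.
From mathcomp Require Import all_boot all_order all_algebra.
From mathcomp Require Import all_classical all_reals all_analysis.
From mathcomp Require Import measurable_realfun.

Set Implicit Arguments.
Unset Strict Implicit.
Unset Printing Implicit Defensive.

Import Order.TTheory GRing.Theory Num.Theory.
Import numFieldTopology.Exports numFieldNormedType.Exports.

Local Open Scope classical_set_scope.
Local Open Scope ring_scope.
Local Open Scope ereal_scope.

(* Lebesgue measure on R^n is built in two steps. First, the n-fold product of
   the one-dimensional Lebesgue measure, on the Borel (product) sigma-algebra
   of n.-tuple R. Second, its completion: the outer measure that it generates
   is moved to 'rV[R]_n and restricted to its Caratheodory-measurable sets,
   which are exactly the Lebesgue-measurable subsets of R^n. *)

Section product_cons.
Context (R : realType) (n : nat).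
Local Notation RT := (measurableTypeR R).

Definition consT (p : RT * n.-tuple RT) : n.+1.-tuple RT :=
  [the n.+1.-tuple RT of p.1 :: p.2].

Lemma measurable_consT : measurable_fun setT consT.
Proof. by apply: measurable_cons. Qed.

Variable m : {sigma_finite_measure set (n.-tuple RT) -> \bar R}.

Definition cons_measure : set (n.+1.-tuple RT) -> \bar R :=
  pushforward (@lebesgue_measure R \x m) consT.

Let cons_measure0 : cons_measure set0 = 0.
Proof. by rewrite /cons_measure /pushforward preimage_set0 measure0. Qed.

Let cons_measure_ge0 A : 0 <= cons_measure A.
Proof. by rewrite /cons_measure /pushforward measure_ge0. Qed.

Let cons_measure_sigma_additive : semi_sigma_additive cons_measure.
Proof.
have mc A : measurable A -> measurable (consT @^-1` A).
  by move=> mA; rewrite -[X in measurable X]setTI; exact: measurable_consT.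
move=> F mF tF mUF; rewrite /cons_measure /pushforward preimage_bigcup.
apply: measure_semi_sigma_additive.
- by move=> k; exact: mc.
- apply/trivIsetP => /= i j _ _ ij; rewrite -preimage_setI.
  by move/trivIsetP : tF => /(_ _ _ _ _ ij) ->//; rewrite preimage_set0.
- by rewrite -preimage_bigcup; exact: mc.
Qed.

HB.instance Definition _ := isMeasure.Build _ _ _ cons_measure
  cons_measure0 cons_measure_ge0 cons_measure_sigma_additive.

Let cons_measure_sigma_finite : sigma_finite setT cons_measure.
Proof.
have [F TF mF] : sigma_finite setT (@lebesgue_measure R \x m).
  have /sigma_finiteP[F [TF ndF Foo]] := sigma_finiteT (@lebesgue_measure R).
  have /sigma_finiteP[G [TG ndG Goo]] := sigma_finiteT m.
  exists (fun k => F k `*` G k).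
    rewrite -setXTT TF TG; apply/seteqP; split=> -[x y].
      move=> [/= [i _ Fx] [j _ Gy]]; exists (maxn i j) => //; split.
        by move: x Fx; exact/subsetPset/ndF/leq_maxl.
      by move: y Gy; exact/subsetPset/ndG/leq_maxr.
    by move=> [i _ []/= ? ?]; split; exists i.
  move=> k; have [? ?] := Foo k; have [? ?] := Goo k.
  split; first exact: measurableX.
  by rewrite product_measure1E// lte_mul_pinfty// ge0_fin_numE.
pose g (t : n.+1.-tuple RT) : RT * n.-tuple RT :=
  (tnth t ord0, [tuple of behead t]).
have gK t : consT (g t) = t.
  by rewrite /consT /g/= [RHS]tuple_eta; apply/val_inj.
have Kg p : g (consT p) = p.
  case: p => a t; rewrite /consT /g/=; congr pair.
  by apply/val_inj.
have mg : measurable_fun setT g.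
  apply/measurable_fun_pairP; split; first exact: measurable_tnth.
  exact: measurable_behead.
exists (fun k => g @^-1` F k).
  by rewrite -preimage_bigcup -TF preimage_setT.
move=> k; have [mFk Fk] := mF k; split.
  by rewrite -[X in measurable X]setTI; exact: mg.
rewrite /cons_measure /pushforward.
suff -> : consT @^-1` (g @^-1` F k) = F k by [].
by apply/seteqP; split => p /=; rewrite Kg.
Qed.

HB.instance Definition _ := Measure_isSigmaFinite.Build _ _ _ cons_measure
  cons_measure_sigma_finite.

End product_cons.

Fixpoint borel_lebesgue (R : realType) (n : nat) :
    {sigma_finite_measure set (n.-tuple (measurableTypeR R)) -> \bar R} :=
  match n with
  | 0 => @dirac _ _ [tuple] R
  | n'.+1 => cons_measure (borel_lebesgue R n')
  end.

Section lebesgue_Rn.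
Context (R : realType) (n : nat).

Definition row_of_tuple (t : n.-tuple (measurableTypeR R)) : 'rV[R]_n :=
  \row_i tnth t i.

Definition outer_lebesgue (A : set 'rV[R]_n) : \bar R :=
  (borel_lebesgue R n)^*%mu (row_of_tuple @^-1` A).

Let outer_lebesgue0 : outer_lebesgue set0 = 0.
Proof. by rewrite /outer_lebesgue preimage_set0 outer_measure0. Qed.

Let outer_lebesgue_ge0 A : 0 <= outer_lebesgue A.
Proof. exact: outer_measure_ge0. Qed.

Let le_outer_lebesgue :
  {homo outer_lebesgue : A B / A `<=` B >-> A <= B}.
Proof. by move=> A B AB; apply: le_outer_measure; exact: preimage_subset. Qed.

Let outer_lebesgue_sigma_subadditive : sigma_subadditive outer_lebesgue.
Proof.
move=> F; rewrite /outer_lebesgue preimage_bigcup.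
exact: outer_measure_sigma_subadditive.
Qed.

HB.instance Definition _ := isOuterMeasure.Build R 'rV[R]_n outer_lebesgue
  outer_lebesgue0 outer_lebesgue_ge0 le_outer_lebesgue
  outer_lebesgue_sigma_subadditive.

(* R^n with the Lebesgue sigma-algebra; convertible to 'rV[R]_n. *)
Definition Rn := caratheodory_type outer_lebesgue.

HB.instance Definition _ := Measurable.on Rn.

Definition lebesgue_Rn : set Rn -> \bar R := outer_lebesgue.

HB.instance Definition _ := isMeasure.Build _ _ _ lebesgue_Rn
  (@caratheodory_measure0 _ _ outer_lebesgue)
  (@caratheodory_measure_ge0 _ _ outer_lebesgue)
  (@caratheodory_measure_sigma_additive _ _ outer_lebesgue).


End lebesgue_Rn.
Lemma measurable_box (R : realType) n (A : 'I_n -> set (measurableTypeR R)) :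
  (forall i, measurable (A i)) ->
  measurable [set t : n.-tuple (measurableTypeR R) | forall i, A i (tnth t i)].
Proof.
move=> mA.
rewrite (_ : [set _ | _] = \bigcap_(i in [set: 'I_n])
    ((@tnth n (measurableTypeR R))^~ i @^-1` A i)); last first.
  by apply/seteqP; split=> t /= h i; [move=> _|]; exact: h.
apply: fin_bigcap_measurable => // i _.
by rewrite -[X in measurable X]setTI; exact: measurable_tnth.
Qed.

Lemma borel_lebesgue_box (R : realType) n (A : 'I_n -> set (measurableTypeR R)) :
  (forall i, measurable (A i)) ->
  borel_lebesgue R n [set t | forall i, A i (tnth t i)] =
  \prod_(i < n) lebesgue_measure (A i).
Proof.
elim: n A => [A _|n ih A mA].
  by rewrite big_ord0 /= diracE mem_set// => -[].
rewrite big_ord_recl -ih//= /cons_measure /pushforward.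
rewrite -product_measure1E//; last exact: (@measurable_box _ _ (fun i => A (lift ord0 i))).
congr (_ _); apply/seteqP; split=> -[x t] /=.
  by move=> h; split => [|i]; [exact: (h ord0)|have := h (lift ord0 i); rewrite tnthS].
move=> [A0 h] i; case: (unliftP ord0 i) => [j ->|->//].
by rewrite tnthS; exact: h.
Qed.

Lemma lebesgue_Rn_box (R : realType) n (A : 'I_n -> set (measurableTypeR R)) :
  (forall i, measurable (A i)) ->
  lebesgue_Rn [set x : 'rV[R]_n | forall i, A i (x ord0 i)] =
  \prod_(i < n) lebesgue_measure (A i).
Proof.
move=> mA; rewrite -borel_lebesgue_box// /lebesgue_Rn /= /outer_lebesgue.
rewrite (_ : _ @^-1` _ = [set t | forall i, A i (tnth t i)]); last first.
  by apply/seteqP; split=> t /= h i; have := h i; rewrite mxE.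
by rewrite measurable_mu_extE//; exact: measurable_box.
Qed.

Section weighted_Musielak_Orlicz.
Context (R : realType) (n : nat).
Local Notation mu := (@lebesgue_Rn R n).

Definition enorm (x : 'rV[R]_n) : R := Num.sqrt (\sum_(i < n) x ord0 i ^+ 2)%R.

(* The library's `ball` on 'rV[R]_n is the one of the sup norm. *)
Definition eball (c : 'rV[R]_n) (r : R) : set (Rn R n) :=
  [set x : 'rV[R]_n | (enorm (x - c) < r)%R].

Definition is_weight (Omega : set (Rn R n)) (w : Rn R n -> \bar R) : Prop :=
  [/\ measurable_fun Omega w,
      {ae mu, forall x, Omega x -> 0 < w x < +oo} &
      forall (c : 'rV[R]_n) (r : R), (0 < r)%R ->
        \int[mu]_(x in eball c r `&` Omega) w x < +oo].

(* Only the values phi x t for x in Omega and t >= 0 are meaningful. *)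
Record Phi_w (Omega : set (Rn R n)) (phi : Rn R n -> R -> \bar R) : Prop := {
  Phi_w_ge0 : forall x (t : R), Omega x -> (0 <= t)%R -> 0 <= phi x t ;
  Phi_w_measurable : forall f : Rn R n -> R, measurable_fun Omega f ->
    measurable_fun Omega (fun x => phi x `|f x|%R) ;
  Phi_w_ndecr : {ae mu, forall x, Omega x ->
    forall s t : R, (0 <= s)%R -> (s <= t)%R -> phi x s <= phi x t} ;
  Phi_w_at0 : {ae mu, forall x, Omega x -> phi x 0%R = 0} ;
  Phi_w_cvg0 : {ae mu, forall x, Omega x -> phi x t @[t --> 0%R^'+] --> 0} ;
  Phi_w_cvgy : {ae mu, forall x, Omega x -> phi x t @[t --> +oo%R] --> +oo} ;
  Phi_w_aInc : exists2 L : R, (1 <= L)%R &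
    {ae mu, forall x, Omega x -> forall s t : R, (0 < s)%R -> (s < t)%R ->
      phi x s / s%:E <= L%:E * (phi x t / t%:E)} }.

(* Extension of phi x to [0, +oo] by its limit at infinity; needed because a
   maximal function may take the value +oo. *)
Definition phi_ext (phi : Rn R n -> R -> \bar R) (x : Rn R n) (t : \bar R) :
    \bar R :=
  if t is t'%:E then phi x t' else +oo.

Definition Lphi_norm (Omega : set (Rn R n)) (w : Rn R n -> \bar R)
    (phi : Rn R n -> R -> \bar R) (f : Rn R n -> \bar R) : \bar R :=
  ereal_inf [set l%:E | l in [set l : R | (0 < l)%R /\
    \int[mu]_(x in Omega) (phi_ext phi x (`|f x| / l%:E) * w x) <= 1]].

Definition Lphi (Omega : set (Rn R n)) (w : Rn R n -> \bar R)
    (phi : Rn R n -> R -> \bar R) : set (Rn R n -> R) :=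
  [set f | measurable_fun Omega f /\
           Lphi_norm Omega w phi (EFin \o f) < +oo].

Definition associate_norm (Omega : set (Rn R n)) (w : Rn R n -> \bar R)
    (phi : Rn R n -> R -> \bar R) (g : Rn R n -> R) : \bar R :=
  ereal_sup [set \int[mu]_(x in Omega) `|f x * g x|%:E | f in
    [set f | measurable_fun Omega f /\ Lphi_norm Omega w phi (EFin \o f) <= 1]].

Definition maximal (Omega : set (Rn R n)) (f : Rn R n -> R) (x : Rn R n) :
    \bar R :=
  ereal_sup [set v | exists (c : 'rV[R]_n) (r : R),
    [/\ (0 < r)%R, eball c r x &
        v = (\int[mu]_(y in eball c r `&` Omega) `|f y|%:E) / mu (eball c r)]].

Definition maximal_bounded (Omega : set (Rn R n)) (w : Rn R n -> \bar R)
    (phi : Rn R n -> R -> \bar R) : Prop :=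
  exists C : R, forall f, Lphi Omega w phi f ->
    Lphi_norm Omega w phi (maximal Omega f) <=
    C%:E * Lphi_norm Omega w phi (EFin \o f).

Definition A_phi (Omega : set (Rn R n)) (phi : Rn R n -> R -> \bar R)
    (w : Rn R n -> \bar R) : Prop :=
  ereal_sup [set v | exists (c : 'rV[R]_n) (r : R),
    [/\ (0 < r)%R, eball c r `&` Omega !=set0 &
        v = Lphi_norm Omega w phi (EFin \o \1_(eball c r `&` Omega)) *
            associate_norm Omega w phi \1_(eball c r `&` Omega) /
            mu (eball c r)]] < +oo.

End weighted_Musielak_Orlicz.

(* Main.v *)
Require Import Defs.
From mathcomp Require Import all_boot all_order all_algebra.
From mathcomp Require Import all_classical all_reals all_analysis.
From mathcomp Require Import measurable_realfun.
Import numFieldTopology.Exports numFieldNormedType.Exports.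
Import Order.TTheory GRing.Theory Num.Theory.

Local Open Scope classical_set_scope.
Local Open Scope ring_scope.

(** Fix a ball B meeting Omega, put N = ||chi_(B n Omega)||, and let f have
norm at most 1.  Every point of B sees B itself in the supremum defining the
maximal function, so M f is bounded below on B n Omega by the average
A = |B|^-1 int_(B n Omega) |f|.  Hence M f dominates k chi_(B n Omega) for
every finite k <= A; the norm is homogeneous and monotone, so k N <= ||M f||,
and ||M f|| <= C ||f|| <= C by boundedness.  Thus N A <= C, and taking the
supremum over f gives N ||chi_(B n Omega)||_X' / |B| <= C uniformly in B.

The comparison k N <= ||M f|| is Lphi_norm_scale_le.  It requires comparing
two integrals when the larger integrand, built from M f, is not known to be
measurable and when the pointwise inequality holds only almost everywhere;
ae_le_integral does this from the definition of the integral as a supremum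
over simple functions.

The factors N, A, |B|^-1 and the associate norm range over [0, +oo], where
multiplication is discontinuous at (0, +oo).  The bounds are therefore passed
to the limit by mule_le_of_fin_lower (from all finite k <= A to A) and by
mule_ereal_sup_le (from each f to the supremum), which hold in these
degenerate cases because the bound C is finite. *)

Section extended_reals.
Local Open Scope ereal_scope.
Context {R : realType}.
Implicit Types (a b : \bar R) (S : set (\bar R)) (C : R).

(** Only the case a = +oo is not a division by a: the finite bound C then forces
every element of S to be nonpositive, so the left-hand side is again
nonpositive. *)
Lemma mule_ereal_sup_le a S C : 0 <= a -> (0 <= C)%R ->
  (forall x, S x -> a * x <= C%:E) -> a * ereal_sup S <= C%:E.
Proof.
move=> a0 C0 SC; case: a a0 SC => [r| |//].
- rewrite lee_fin le_eqVlt => /predU1P[<- _|r0 SC]; first by rewrite mul0e.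
  by rewrite -lee_pdivlMl//; apply: ge_ereal_sup => x /SC; rewrite lee_pdivlMl.
- move=> _ SC; apply: (@le_trans _ _ 0); last by rewrite lee_fin.
  apply: mule_ge0_le0 => //; apply: ge_ereal_sup => x Sx.
  by rewrite leNgt; apply/negP => x0; have := SC _ Sx; rewrite gt0_mulye.
Qed.

(** If b = +oo, then a <= C / k for every k > 0, so a = 0 and the product is 0. *)
Lemma mule_le_of_fin_lower a b C : 0 <= a -> 0 <= b -> (0 <= C)%R ->
  (forall k : R, (0 < k)%R -> k%:E <= b -> k%:E * a <= C%:E) ->
  a * b <= C%:E.
Proof.
move=> a0 b0 C0 kC; case: b b0 kC => [r| |//].
- rewrite lee_fin le_eqVlt => /predU1P[<- _|r0 kC]; first by rewrite mule0.
  by rewrite muleC; exact: kC.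
- move=> _ kC; suff -> : a = 0 by rewrite mul0e.
  apply/eqP; rewrite eq_le a0 andbT; apply/lee_addgt0Pr => e e0; rewrite add0e.
  (* C + 1 rather than C, so that k is positive also when C = 0 *)
  have k0 : (0 < (C + 1) / e)%R by rewrite divr_gt0// ltr_wpDl.
  have := kC _ k0 (leey _); rewrite -lee_pdivlMl// => /le_trans; apply.
  rewrite -EFinM lee_fin invf_div mulrAC ler_pdivrMr ?ltr_wpDl//.
  by rewrite ler_pM2l// lerDl.
Qed.

End extended_reals.

Section integral_without_measurability.
Local Open Scope ereal_scope.
Context d (T : measurableType d) (R : realType).
Variable mu : {measure set T -> \bar R}.
Import HBNNSimple.

(** Neither function is assumed measurable.  A simple function below f, once set
to 0 on a measurable null set containing the exceptional points, lies below g
everywhere and has the same integral; so the supremum over simple functions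
below f is at most the one for g. *)
Lemma ae_le_integral_nonneg (f g : T -> \bar R) :
  (forall x, 0 <= f x) -> (forall x, 0 <= g x) ->
  {ae mu, forall x, f x <= g x} -> \int[mu]_x f x <= \int[mu]_x g x.
Proof.
move=> f0 g0 [N [mN N0 fgN]].
rewrite [leLHS]ge0_integralTE// [leRHS]ge0_integralTE//.
apply: ge_ereal_sup => _ [h /= hf <-].
have mNc : measurable (~` N) by exact: measurableC.
apply: ereal_sup_ubound; exists (proj_nnsfun h mNc) => /=.
  move=> x; rewrite mindicE; case: (boolP (x \in ~` N)) => [|_].
    rewrite mulr1 inE => xN; apply: le_trans (hf x) _.
    by apply: contrapT => fg; apply: xN; exact: fgN.
  by rewrite mulr0.
rewrite -!integralT_nnsfun; apply: ge0_ae_eq_integral => //.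
- exact/measurable_EFinP.
- exact/measurable_EFinP.
- by move=> x _; rewrite lee_fin.
- by move=> x _; rewrite lee_fin.
exists N; split => // x /= hx; apply: contrapT => xN; apply: hx => _.
by rewrite mindicE mem_set ?mulr1.
Qed.

(** The integrands may be negative on a null set, so their negative parts have
to be compared as well; both are almost everywhere 0. *)
Lemma ae_le_integral (D : set T) (f g : T -> \bar R) :
  {ae mu, forall x, D x -> 0 <= f x <= g x} ->
  \int[mu]_(x in D) f x <= \int[mu]_(x in D) g x.
Proof.
move=> fg; rewrite integral_mkcond [leRHS]integral_mkcond.
rewrite integralE [leRHS]integralE.
apply: leeB; apply: ae_le_integral_nonneg => //.
all: apply: filterS fg => x /= fg.
all: rewrite ?funeposE ?funenegE /patch.
all: case: ifPn => //; rewrite inE => /fg /andP[f0 fgx].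
  by rewrite ge_max le_max fgx /= le_max lexx orbT.
by rewrite ge_max !le_max lexx oppe_le0 (le_trans f0 fgx) !orbT.
Qed.

End integral_without_measurability.

Section Luxemburg_functional.
Local Open Scope ereal_scope.
Context {R : realType} {n : nat}.
Variables (Omega : set (Rn R n)) (w : Rn R n -> \bar R).
Variable phi : Rn R n -> R -> \bar R.
Local Notation mu := (@lebesgue_Rn R n).
Local Notation norm := (Lphi_norm Omega w phi).

Lemma Lphi_norm_ge0 f : 0 <= norm f.
Proof.
by apply: le_ereal_inf_tmp => _ [l [l0 _] <-]; rewrite lee_fin ltW.
Qed.

(** If l is admissible in the infimum defining ||g||, then l / k is admissible for
||f||, as |f| / (l / k) = k |f| / l <= |g| / l on Omega and phi is
nondecreasing in its second argument.  This combines monotonicity with one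
half of homogeneity. *)
Lemma Lphi_norm_scale_le (k : R) (f g : Rn R n -> \bar R) :
  is_weight Omega w -> Phi_w Omega phi -> (0 < k)%R ->
  (forall x, Omega x -> k%:E * `|f x| <= `|g x|) ->
  k%:E * norm f <= norm g.
Proof.
move=> [_ w0 _] Phi k0 kfg.
apply: le_ereal_inf_tmp => _ [l [l0 gl] <-].
rewrite -lee_pdivlMl//; apply: ereal_inf_lbound.
exists (k^-1 * l)%R; last by rewrite EFinM.
split; first by rewrite mulr_gt0// invr_gt0.
apply: le_trans gl; apply: ae_le_integral.
apply: filterS2 w0 (Phi_w_ndecr Phi) => x w0 ndx Ox.
have {w0}/andP[/ltW w0 _] := w0 Ox.
have l'0 : (k^-1 * l)%R != 0%R by rewrite mulf_neq0// ?invr_eq0 gt_eqF.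
have fl0 : 0 <= `|f x| / (k^-1 * l)%:E.
  by rewrite mule_ge0// inver (negbTE l'0) lee_fin invr_ge0 mulr_ge0// ?invr_ge0 ltW.
have fgl : `|f x| / (k^-1 * l)%:E <= `|g x| / l%:E.
  rewrite !inver (negbTE l'0) gt_eqF// lee_pdivlMr//.
  rewrite -muleA -EFinM invfM invrK -mulrA mulVf ?gt_eqF// mulr1.
  by rewrite muleC; exact: kfg.
have phi0 : 0 <= phi_ext phi x (`|f x| / (k^-1 * l)%:E).
  case: (_ / _) fl0 => [s||]//= s0; exact: Phi_w_ge0 Phi _ _ Ox s0.
rewrite mule_ge0//= lee_wpmul2r//.
case: (`|g x| / _) fgl => [t||]/=; case: (`|f x| / _) fl0 => [s||]//=.
- by rewrite !lee_fin => s0 st; exact: (ndx Ox).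
- by move=> _ _; exact: leey.
Qed.

End Luxemburg_functional.

Theorem theorem2p15 (R : realType) (n : nat) (Omega : set 'rV[R]_n)
    (w : Rn R n -> \bar R) (phi : Rn R n -> R -> \bar R) :
  open Omega ->
  is_weight Omega w ->
  Phi_w Omega phi ->
  (forall (c : 'rV[R]_n) (r : R), 0 < r -> eball c r `&` Omega !=set0 ->
     Lphi Omega w phi \1_(eball c r `&` Omega)) ->
  maximal_bounded Omega w phi ->
  A_phi Omega phi w.
Proof.
move=> _ ww Phi _ [C MC].
(* A negative C would reverse C ||f|| <= C for ||f|| <= 1. *)
pose K := Num.max C 0.
have K0 : 0 <= K by rewrite le_max lexx orbT.
apply: (@le_lt_trans _ _ K%:E); last exact: ltry.
apply: ge_ereal_sup => _ [c [r [r0 _ ->]]].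
set B := eball c r; set N := Lphi_norm _ _ _ _.
set e := ((lebesgue_Rn B)^-1)%E.
have N0 : (0 <= N)%E by exact: Lphi_norm_ge0.
have e0 : (0 <= e)%E by rewrite inve_ge0.
(* The product is grouped as (N * e) * (supremum over f). *)
rewrite muleAC; apply: mule_ereal_sup_le => //; first exact: mule_ge0.
move=> _ [f [mf f1] <-].
set I := integral _ _ _.
have -> : I = (\int[@lebesgue_Rn R n]_(y in B `&` Omega) `|f y|%:E)%E.
  rewrite /I integral_mkcond [RHS]integral_mkcond; congr integral.
  apply/funext => y; rewrite /patch in_setI.
  case: ifPn => yO; last by rewrite andbF.
  rewrite andbT indicE in_setI yO andbT.
  by case: ifPn => _; rewrite ?mulr1// mulr0 normr0.
set J := integral _ _ _.
have J0 : (0 <= J)%E by apply: integral_ge0 => y _; rewrite lee_fin.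
(* Regrouped as N * A, where A = e * J is the average of |f| over B; A may be
   infinite. *)
rewrite -muleA; apply: mule_le_of_fin_lower => //.
  by rewrite mule_ge0.
move=> k k0 kJ.
have fL : Lphi Omega w phi f by split => //; apply: le_lt_trans f1 (ltry _).
apply: (@le_trans _ _ (Lphi_norm Omega w phi (maximal Omega f))).
  apply: Lphi_norm_scale_le => // x Ox.
  rewrite /= indicE in_setI (mem_set Ox) andbT.
  case: (boolP (x \in B)) => [/[!inE] xB|_]; last first.
    by rewrite normr0 mule0 abse_ge0.
  rewrite normr1 mule1; apply: le_trans (lee_abs _).
  apply: le_trans kJ _; apply: ereal_sup_ubound; exists c, r; split => //.
  by rewrite muleC.
apply: le_trans (MC _ fL) _.
apply: (@le_trans _ _ (K%:E * Lphi_norm Omega w phi (EFin \o f))%E).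
  by apply: lee_wpmul2r; [exact: Lphi_norm_ge0|rewrite lee_fin le_max lexx].
by rewrite -[leRHS]mule1; apply: lee_wpmul2l.
Qed.
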